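(* Let $\Gamma'\subset\Gamma$ be elliptic graphs, $\Gamma'$ a proper connected full subgraph, with index of extension $i=i_{(\Gamma',\Gamma)}$. If every $v\in\partial_\Gamma(\Gamma')$ is an end-vertex of $\Gamma'$, then for every $j\ge i-1$ and every $\ell\in Supp_j(P_0^\Gamma)$ one has $\ell|_{\Gamma'}\in Supp_{j-i}(P_0^{\Gamma'})$.
   Context: For a decorated tree $G$ (vertex set $\mathcal V(G)$, integer decorations $e_v$, genera zero, negative definite form on $L(G)=\mathbb Z\langle E_v\rangle$ with $(E_v,E_v)=e_v$, $(E_v,E_w)=1$ for adjacent $v\ne w$, $0$ otherwise) let $L'(G)$ be the dual lattice, $[l']$ the class in $L'(G)/L(G)$, $E_v^*$ with $(E_v^*,E_w)=-\delta_{vw}$, $\delta_v$ the valency, $E^G=\sum E_v$, $Z_K^G$ with $(Z_K^G,E_v)=e_v+2$, $\chi(l')=-(l',l'-Z_K^G)/2$. $\ge$ is coordinatewise, $\prec$ strict in every coordinate, $l>0$ if $l\ge0,l\ne0$, $|l'|$ the support, $\ell|_{G'}$ the restriction of coefficients to the vertices of a subgraph $G'$. $\mathcal S'(G)=\{l':(l',E_v)\le0\ \forall v\}$, $s_h=\min\{l'\in\mathcal S'(G):[l']=h\}$, $Z_{min}(B)$ the minimal nonzero element of $\mathcal S'(B)\cap L(B)$. $Z^G(\mathbf t)=\sum z^G(l')\mathbf t^{l'}$ is the Taylor expansion at $0$ of $\prod_v(1-\mathbf t^{E_v^*})^{\delta_v-2}$; $P_0^G(\mathbf t)=\sum_{\ell\in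 L(G),\ell\not\prec0}w^G(\ell)\mathbf t^\ell$ with $w^G(\ell)=z^G(Z_K^G-E^G-\ell)$; $Supp(P_0^G)=\{\ell\not\prec0:w^G(\ell)\ne0\}$. Elliptic graph: $e_v\le-2$ for all $v$ and $\min_{l\in L(G),l>0}\chi(l)=0$. NN-elliptic sequence: $B^G_{-1}=G$, $Z_{B_{-1}}=s_{[Z^G_K]}$, $B^G_0=|Z^G_K-s_{[Z^G_K]}|$; for $j\ge0$, $Z_{B_j}=Z_{min}(B^G_j)$, and if $Z^G_K-\sum_{i=-1}^jZ_{B_i}\ne0$ then $B^G_{j+1}=|Z^G_K-\sum_{i=-1}^jZ_{B_i}|$; $m$ is the index with $Z^G_K=\sum_{i=-1}^mZ_{B_i}$; $C^G_j=\sum_{i=-1}^jZ_{B_i}$. For $\ell\in Supp(P_0^G)$ with $\mathcal V^{<0}(\ell)=\{v:\ell_v<0\}$, its associated cycle is the unique $l'$ with $\ell=Z^G_K-E^G-l'-\sum_{v\in\mathcal V^{<0}(\ell)}m_vE_v$, $l'\le Z^G_K$, $l'_v=(Z^G_K)_v$ on $\mathcal V^{<0}(\ell)$, $m_v\in\mathbb Z_{\ge0}$; $Supp_j(P_0^G)$ is the set of $\ell$ with associated cycle $C^G_j$. $\partial_\Gamma(\Gamma')$ is the set of vertices of $\Gamma'$ adjacent to a vertex of $\Gamma\setminus\Gamma'$; an end-vertex of $\Gamma'$ has valency 1 in $\Gamma'$. It is known that there is a unique integer $i_{(\Gamma',\Gamma)}\ge0$ (index of the extension) with $B^\Gamma_i\subseteq\Gamma'\subsetneq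 B^\Gamma_{i-1}$, and that the NN-elliptic sequence of $\Gamma'$ is $\Gamma',B^\Gamma_i,B^\Gamma_{i+1},\dots,B^\Gamma_m$. *)

(* Defs.v *)
(* Decorated trees are modelled as induced subgraphs (vertex
   sets S : {set T}) of an ambient graph on a finite type T with adjacency
   [adj] and integer decorations [e].  Cycles (elements of L(S) ⊗ Q) are
   finite functions T -> rat, supported on S. *)
From HB Require Import structures.
From mathcomp Require Import all_boot all_order all_algebra.
Set Implicit Arguments. Unset Strict Implicit. Unset Printing Implicit Defensive.
Import Order.TTheory GRing.Theory Num.Theory.
Local Open Scope ring_scope.

Notation cyc T := {ffun T -> rat}.

Section Plumbing.
Variables (T : finType) (adj : rel T) (e : T -> int).

Definition Ient (v w : T) : rat :=
  if v == w then (e v)%:~R else if adj v w then 1 else 0.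

Definition form (S : {set T}) (x y : cyc T) : rat :=
  \sum_(v in S) \sum_(w in S) x v * y w * Ient v w.

Definition Ev (v : T) : cyc T := [ffun w => (w == v)%:R].
Definition EG (S : {set T}) : cyc T := [ffun w => (w \in S)%:R].

Definition cscale (a : rat) (x : cyc T) : cyc T := [ffun w => a * x w].

Definition supp_on (S : {set T}) (x : cyc T) := forall v, v \notin S -> x v = 0.
Definition support (x : cyc T) : {set T} := [set v | x v != 0].
Definition restrict (S : {set T}) (x : cyc T) : cyc T :=
  [ffun v => if v \in S then x v else 0].

Definition inL (S : {set T}) (x : cyc T) :=
  supp_on S x /\ forall v, x v \is a Num.int.
Definition inL' (S : {set T}) (x : cyc T) :=
  supp_on S x /\ forall v, v \in S -> form S x (Ev v) \is a Num.int.
Definition inS' (S : {set T}) (x : cyc T) :=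
  forall v, v \in S -> form S x (Ev v) <= 0.

Definition cle (x y : cyc T) := forall v, x v <= y v.
Definition cpos (S : {set T}) (x : cyc T) := cle 0 x /\ x != 0.
Definition is_least (P : cyc T -> Prop) (x : cyc T) :=
  P x /\ forall y, P y -> cle x y.

Definition valency (S : {set T}) (v : T) : nat := #|[set w in S | adj v w]|.
Definition relS (S : {set T}) : rel T := [rel x y | [&& adj x y, x \in S & y \in S]].
Definition connectedS (S : {set T}) :=
  forall x y, x \in S -> y \in S -> connect (relS S) x y.
Definition nedges2 (S : {set T}) : nat :=
  #|[set p : T * T | [&& p.1 \in S, p.2 \in S & adj p.1 p.2]]|.
(* a tree: nonempty, connected, #edges = #vertices - 1 (edges counted twice) *)
Definition treeS (S : {set T}) :=
  [/\ S != set0, connectedS S & nedges2 S = (#|S|.-1).*2].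
Definition negdef (S : {set T}) :=
  forall x : cyc T, supp_on S x -> x != 0 -> form S x x < 0.
Definition boundary (G G' : {set T}) : {set T} :=
  [set v in G' | [exists w, (w \in G :\: G') && adj v w]].

(* E_v^* : the dual basis, (E_v^*, E_w) = - delta_vw, computed by matrix inverse
   of the intersection matrix of S (extended by the identity outside S) *)
Definition Imx (S : {set T}) : 'M[rat]_#|T| :=
  \matrix_(i, j) (if (enum_val i \in S) && (enum_val j \in S)
                  then Ient (enum_val i) (enum_val j) else (i == j)%:R).
Definition dual (S : {set T}) (v : T) : cyc T :=
  [ffun w => if w \in S then - invmx (Imx S) (enum_rank v) (enum_rank w) else 0].

(* canonical cycle Z_K : (Z_K, E_v) = e_v + 2 *)
Definition ZK (S : {set T}) : cyc T :=
  \sum_(v in S) cscale (- ((e v)%:~R + 2)) (dual S v).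

Definition chi (S : {set T}) (x : cyc T) : rat := - form S x (x - ZK S) / 2.

Definition elliptic (S : {set T}) :=
  [/\ treeS S, negdef S, (forall v, v \in S -> e v <= -2),
      (forall l, inL S l -> cpos S l -> 0 <= chi S l) &
      (exists l, [/\ inL S l, cpos S l & chi S l = 0])].

(* coefficient of x^k in (1 - x)^n, n an integer *)
Definition coefpow (n : int) (k : nat) : rat :=
  (-1) ^+ k * (\prod_(i < k) (n%:~R - i%:R)) / (k`!)%:R.

(* a bound on the exponents k_v occurring in the coefficient of t^l' *)
Definition zbound (S : {set T}) (l' : cyc T) : nat :=
  \sum_(v in S) absz (Num.floor (l' v / dual S v v)).

(* z^S(l') : Taylor coefficient of t^{l'} in prod_v (1 - t^{E_v^*})^(delta_v - 2) *)
Definition zcoef (S : {set T}) (l' : cyc T) : rat :=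
  \sum_(k : {ffun T -> 'I_(zbound S l').+1} |
        [forall v, (v \notin S) ==> (val (k v) == 0%N)] &&
        (\sum_(v in S) cscale (val (k v))%:R (dual S v) == l'))
     \prod_(v in S) coefpow ((valency S v)%:Z - 2) (val (k v)).

Definition wcoef (S : {set T}) (l : cyc T) : rat := zcoef S (ZK S - EG S - l).

Definition inSupp (S : {set T}) (l : cyc T) :=
  [/\ inL S l, ~ (forall v, v \in S -> l v < 0) & wcoef S l != 0].

Definition assoc_cycle (S : {set T}) (l l' : cyc T) :=
  [/\ exists m : T -> nat,
        l = ZK S - EG S - l' - \sum_(v in S | l v < 0) cscale (m v)%:R (Ev v),
      cle l' (ZK S) &
      forall v, v \in S -> l v < 0 -> l' v = ZK S v].

Definition SuppJ (S : {set T}) (C : cyc T) (l : cyc T) :=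
  inSupp S l /\ assoc_cycle S l C.

(* NN-elliptic sequence, shifted index: B k = B_{k-1}, Z k = Z_{B_{k-1}},
   k = 0 .. m  (so m = m_paper + 1) *)
Definition Cseq (Z : nat -> cyc T) (k : nat) : cyc T := \sum_(i < k.+1) Z i.

Definition NNseq (S : {set T}) (B : nat -> {set T}) (Z : nat -> cyc T) (m : nat) :=
  [/\ B 0%N = S,
      is_least (fun x => [/\ inL' S x, inS' S x & inL S (x - ZK S)]) (Z 0%N),
      (forall k, (0 < k <= m)%N ->
         is_least (fun x => [/\ inL (B k) x, x != 0 & inS' (B k) x]) (Z k)),
      (forall k, (k < m)%N ->
         ZK S - Cseq Z k != 0 /\ B k.+1 = support (ZK S - Cseq Z k)) &
      ZK S = Cseq Z m].

End Plumbing.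

(* Main.v *)
Require Import Defs.
From HB Require Import structures.
From mathcomp Require Import all_boot all_order all_algebra.
From mathcomp Require Import ring lra zify.
Import Order.TTheory GRing.Theory Num.Theory.
Local Open Scope ring_scope.

(** Put X_k = Z_K - C_k.  By ellipticity chi(X_k) = (C_k, X_k) / 2 >= 0, while
    C_k is anti-nef on |X_k| = B_(k+1), so C_k is orthogonal to B_(k+1).  From
    this one gets that the least element of S'(G') in the class of Z_K' is
    Z_K' - X_i; hence both NN-elliptic sequences continue in the same way and
    have the same remainders, Z_K' - C'_(k-i) = X_k.  A cycle l lies in
    Supp_k iff w(l) <> 0 and l = X_k - E - sum_(l_v < 0) m_v E_v with X_k = 0
    wherever l < 0, and this description restricts to G'.

    Since the E_v^* form a basis, w(l) <> 0 iff for all v the number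
    k_v = valency(v) - 2 + (l, E_v) is >= 0, and <= valency(v) - 2 unless
    valency(v) <= 1.  Passing to G' changes k_v only on the boundary, where it
    increases; there the valency in G' is 1, so no upper bound is imposed. *)

(** * The intersection pairing and negative definiteness *)

Section Intersection.
Variables (T : finType) (adj : rel T) (e : T -> int).
Implicit Types (S : {set T}) (x y : cyc T) (u v w : T).
Hypotheses (Hsym : symmetric adj) (Hirr : irreflexive adj).

Local Notation Ient := (Defs.Ient adj e).
Local Notation form := (Defs.form adj e).
Local Notation ZK := (Defs.ZK adj e).
Local Notation dual := (Defs.dual adj e).

Lemma cycBE x y v : (x - y) v = x v - y v.
Proof. by rewrite [LHS]ffunE [X in _ + X = _]ffunE. Qed.

(** Unlike [form S x (Ev v)], which is 0 for [v] outside [S], this sum still computes the pairing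
    with [E_v] there, as needed when a cycle on [S] is viewed in a larger graph. *)
Definition pair_Ev (S : {set T}) (x : cyc T) (v : T) : rat :=
  \sum_(u in S) x u * Ient u v.

Lemma IentC u v : Ient u v = Ient v u.
Proof.
rewrite /Defs.Ient (eq_sym v u) Hsym.
by case: eqP => [->|].
Qed.

Lemma Ient_ge0 u v : u != v -> 0 <= Ient u v.
Proof. by rewrite /Defs.Ient => /negbTE ->; case: ifP. Qed.

Lemma Ient_int u v : Ient u v \is a Num.int.
Proof.
rewrite /Defs.Ient; case: ifP => _; first exact: rpred_int.
by case: ifP => _; rewrite ?rpred0 ?rpred1.
Qed.

Lemma formE S x y : form S x y = \sum_(v in S) y v * pair_Ev S x v.
Proof.
rewrite /Defs.form exchange_big /=; apply: eq_bigr => v _.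
by rewrite mulr_sumr; apply: eq_bigr => u _; ring.
Qed.

Lemma formC S x y : form S x y = form S y x.
Proof.
rewrite /Defs.form exchange_big /=; apply: eq_bigr => u _; apply: eq_bigr => v _.
by rewrite IentC (mulrC (x v)).
Qed.

Lemma form_Ev S x v : v \in S -> form S x (Ev v) = pair_Ev S x v.
Proof.
move=> vS; rewrite formE (bigD1 v) //= big1 => [|w /andP[_ /negbTE nwv]].
  by rewrite ffunE eqxx addr0 mul1r.
by rewrite ffunE nwv mul0r.
Qed.

Lemma pair_EvD S x y v : pair_Ev S (x + y) v = pair_Ev S x v + pair_Ev S y v.
Proof.
by rewrite -big_split /=; apply: eq_bigr => u _; rewrite ffunE mulrDl.
Qed.

Lemma pair_EvN S x v : pair_Ev S (- x) v = - pair_Ev S x v.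
Proof. by rewrite -sumrN; apply: eq_bigr => u _; rewrite ffunE mulNr. Qed.

Lemma pair_EvB S x y v : pair_Ev S (x - y) v = pair_Ev S x v - pair_Ev S y v.
Proof. by rewrite pair_EvD pair_EvN. Qed.

Lemma pair_Ev_scale S a x v : pair_Ev S (cscale a x) v = a * pair_Ev S x v.
Proof.
by rewrite mulr_sumr; apply: eq_bigr => u _; rewrite ffunE mulrA.
Qed.

Lemma pair_Ev_sum S I (r : seq I) (P : pred I) (f : I -> cyc T) v :
  pair_Ev S (\sum_(i <- r | P i) f i) v = \sum_(i <- r | P i) pair_Ev S (f i) v.
Proof.
rewrite /pair_Ev exchange_big /=; apply: eq_bigr => u _.
by rewrite sum_ffunE mulr_suml.
Qed.

Lemma pair_Ev_sub {S S' : {set T}} {x} v :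
  S' \subset S -> supp_on S' x -> pair_Ev S x v = pair_Ev S' x v.
Proof.
move=> /subsetP sub supp; rewrite /pair_Ev [LHS](bigID (mem S')) /=.
rewrite [X in _ + X]big1 => [|u /andP[_ /supp ->]]; last by rewrite mul0r.
rewrite addr0; apply: eq_bigl => u; rewrite andb_idl //; exact: sub.
Qed.

Lemma pair_Ev_int S x v :
  (forall u, x u \is a Num.int) -> pair_Ev S x v \is a Num.int.
Proof. by move=> xi; apply: rpred_sum => u _; rewrite rpredM ?Ient_int. Qed.

Lemma pair_Ev_ge0_out S (x : cyc T) v :
  (forall u, 0 <= x u) -> v \notin S -> 0 <= pair_Ev S x v.
Proof.
move=> x0 vS; apply: sumr_ge0 => u uS; apply: mulr_ge0 => //.
by apply: Ient_ge0; apply: contraNneq vS => <-.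
Qed.

Lemma form_sub {S S' : {set T}} {x} :
  S' \subset S -> supp_on S' x -> form S x x = form S' x x.
Proof.
move=> sub supp; rewrite !formE (bigID (mem S')) /=.
rewrite [X in _ + X]big1 => [|u /andP[_ /supp ->]]; last by rewrite mul0r.
rewrite addr0; apply: eq_big => [u|u _]; last by rewrite (pair_Ev_sub _ sub).
by rewrite andb_idl //; apply: (subsetP sub).
Qed.

Lemma supp_onS {S S' : {set T}} {x : cyc T} : S' \subset S -> supp_on S' x -> supp_on S x.
Proof. by move=> /subsetP sub supp v vS; apply: supp; apply: contra vS => /sub. Qed.

Lemma negdefS {S S' : {set T}} : S' \subset S -> negdef adj e S -> negdef adj e S'.
Proof.
by move=> sub nd x supp x0; rewrite -(form_sub sub supp) nd //; apply: supp_onS supp.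
Qed.

(* Pair an anti-nef x with its negative part n: (x, n) <= 0, whereas
   (x, n) = (x^+, n) - (n, n) > 0 unless n = 0. *)
Lemma antinef_ge0 S (x : cyc T) : negdef adj e S ->
  (forall v, v \in S -> pair_Ev S x v <= 0) -> forall v, v \in S -> 0 <= x v.
Proof.
move=> nd xS.
pose n : cyc T := [ffun v => if v \in S then Num.max 0 (- x v) else 0].
have n_ge0 v : 0 <= n v by rewrite ffunE; case: ifP => // _; rewrite le_max lexx.
have n_supp : supp_on S n by move=> v /negbTE vS; rewrite ffunE vS.
case: (eqVneq n 0) => [n0 v vS|/(nd n n_supp) nn_lt0].
  move/ffunP/(_ v): n0; rewrite !ffunE vS => mx.
  by rewrite -oppr_le0 -[leRHS]mx le_max lexx orbT.
have xn_le0 : form S x n <= 0.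
  by rewrite formE; apply: sumr_le0 => v vS; apply: mulr_ge0_le0 => //; apply: xS.
suff : 0 <= \sum_(v in S) n v * pair_Ev S (x + n) v.
  under eq_bigr => v _ do rewrite pair_EvD mulrDr.
  rewrite big_split /= -!formE => ?; lra.
apply: sumr_ge0 => v vS; rewrite mulr_sumr; apply: sumr_ge0 => u uS.
have pos_ge0 w : w \in S -> 0 <= (x + n) w.
  by move=> wS; rewrite !ffunE wS; case: (leP 0 (- x w)) => ?; lra.
have disj : n v * (x + n) v = 0.
  by rewrite !ffunE vS; case: (leP 0 (- x v)) => ?; rewrite ?addrN ?mulr0 ?mul0r.
case: (eqVneq u v) => [->|uv]; first by rewrite mulrA disj mul0r.
by rewrite !mulr_ge0 ?pos_ge0 ?Ient_ge0.
Qed.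

(** * The dual basis and the canonical cycle *)

Lemma Imx_rankE S u v : Imx adj e S (enum_rank u) (enum_rank v) =
  if (u \in S) && (v \in S) then Ient u v else (u == v)%:R.
Proof. by rewrite mxE !enum_rankK (inj_eq enum_rank_inj). Qed.

(** A row in the left kernel vanishes outside [S], where the matrix is the identity. Its part on [S]
    is orthogonal to every [E_v], so it has self-intersection 0 and is zero by definiteness. *)
Lemma Imx_unit S : negdef adj e S -> Imx adj e S \in unitmx.
Proof.
move=> nd; rewrite -row_free_unit -kermx_eq0; apply/eqP/row_matrixP => i.
rewrite row0; set r := row i _.
have rI : r *m Imx adj e S = 0 by rewrite -row_mul mulmx_ker row0.
pose x : cyc T := [ffun v => if v \in S then r 0 (enum_rank v) else 0].
have entry v : \sum_u r 0 (enum_rank u) * Imx adj e S (enum_rank u) (enum_rank v) = 0.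
  move/matrixP/(_ 0 (enum_rank v)): rI; rewrite !mxE => rv; rewrite -[RHS]rv.
  by rewrite [RHS](reindex _ (onW_bij _ (@enum_rank_bij T))).
have rout v : v \notin S -> r 0 (enum_rank v) = 0.
  move=> vS; rewrite -[RHS](entry v) (bigD1 v) //= big1 => [|u uv].
    by rewrite Imx_rankE (negbTE vS) eqxx mulr1 addr0.
  by rewrite Imx_rankE (negbTE vS) andbF (negbTE uv) mulr0.
have x_supp : supp_on S x by move=> v /negbTE vS; rewrite ffunE vS.
have x_pair v : v \in S -> pair_Ev S x v = 0.
  move=> vS; rewrite -[RHS](entry v) [RHS](bigID (mem S)) /=.
  rewrite [X in _ + X]big1 => [|u uS]; last by rewrite rout ?mul0r.
  rewrite addr0; apply: eq_bigr => u uS.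
  by rewrite ffunE uS Imx_rankE uS vS.
have x0 : x = 0.
  apply/eqP/negP => /negP /(nd x x_supp).
  by rewrite formE big1 ?ltxx // => v vS; rewrite x_pair ?mulr0.
apply/rowP => j; rewrite [RHS]mxE -[j]enum_valK.
case: (boolP (enum_val j \in S)) => [jS|/rout //].
by move/ffunP/(_ (enum_val j)): x0; rewrite !ffunE jS.
Qed.

Lemma pair_dual S v w : negdef adj e S -> v \in S -> w \in S ->
  pair_Ev S (dual S v) w = - (v == w)%:R.
Proof.
move=> nd vS wS.
have /matrixP/(_ (enum_rank v) (enum_rank w)) := mulVmx (Imx_unit S nd).
rewrite mxE [RHS]mxE (inj_eq enum_rank_inj) => <-.
rewrite (reindex _ (onW_bij _ (@enum_rank_bij T))) (bigID (mem S)) /=.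
rewrite [X in _ + X]big1 => [|u /negbTE uS]; last first.
  rewrite Imx_rankE uS /=.
  by case: eqP wS => [<-|_ _]; rewrite ?mulr0 ?uS.
rewrite addr0 -sumrN; apply: eq_bigr => u uS.
by rewrite ffunE uS Imx_rankE uS wS mulNr.
Qed.

Lemma supp_dual S v : supp_on S (dual S v).
Proof. by move=> w /negbTE wS; rewrite ffunE wS. Qed.

Lemma supp_comb S (a : T -> rat) :
  supp_on S (\sum_(v in S) cscale (a v) (dual S v)).
Proof.
move=> w wS; rewrite sum_ffunE big1 // => v _.
by rewrite ffunE (supp_dual S v w wS) mulr0.
Qed.

Lemma pair_comb S (a : T -> rat) w : negdef adj e S -> w \in S ->
  pair_Ev S (\sum_(v in S) cscale (a v) (dual S v)) w = - a w.
Proof.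
move=> nd wS; rewrite pair_Ev_sum (bigD1 w) //= big1 => [|v /andP[vS /negbTE vw]].
  by rewrite pair_Ev_scale pair_dual // eqxx mulrN1 addr0.
by rewrite pair_Ev_scale pair_dual // vw oppr0 mulr0.
Qed.

Lemma pair_ZK S v : negdef adj e S -> v \in S -> pair_Ev S (ZK S) v = (e v)%:~R + 2.
Proof. by move=> nd vS; rewrite pair_comb // opprK. Qed.

Lemma supp_ZK S : supp_on S (ZK S).
Proof. exact: supp_comb. Qed.

Lemma dual_ge0 S v w : negdef adj e S -> v \in S -> w \in S -> 0 <= dual S v w.
Proof.
move=> nd vS wS; apply: (antinef_ge0 S) => // u uS.
by rewrite pair_dual // oppr_le0 ler0n.
Qed.

(** This coordinate is minus the self-intersection of [dual S v]; were it 0, definiteness would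
    force [dual S v] to vanish, although it pairs to -1 with [E_v]. *)
Lemma dual_gt0 S v : negdef adj e S -> v \in S -> 0 < dual S v v.
Proof.
move=> nd vS; rewrite lt0r dual_ge0 // andbT; apply: contraTneq isT => dvv.
have d0 : dual S v != 0.
  apply: contraTneq isT => d0; have := pair_dual S v v nd vS vS.
  rewrite d0 eqxx /pair_Ev big1 => [/eqP|u _]; last by rewrite ffunE mul0r.
  by rewrite eq_sym oppr_eq0 oner_eq0.
have := nd _ (supp_dual S v) d0; rewrite formE big1 ?ltxx // => u uS.
rewrite pair_dual //; case: eqP => [<-|_]; first by rewrite dvv mul0r.
by rewrite oppr0 mulr0.
Qed.

(** * Nonvanishing coefficients of the series *)

Lemma pair_inj S x y : negdef adj e S -> supp_on S x -> supp_on S y ->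
  (forall v, v \in S -> pair_Ev S x v = pair_Ev S y v) -> x = y.
Proof.
move=> nd sx sy xy; apply/eqP; rewrite -subr_eq0; apply/negP => /negP xy0.
have sxy : supp_on S (x - y) by move=> v vS; rewrite !ffunE sx ?sy ?subr0.
have := nd _ sxy xy0; rewrite formE big1 ?ltxx // => v vS.
by rewrite pair_EvB xy // subrr mulr0.
Qed.

(** Pairing with [E_v] recovers the exponent of [dual S v], so at most one index contributes to the
    sum and no cancellation can occur. *)
Lemma zcoef_neq0P S x : negdef adj e S -> supp_on S x ->
  zcoef adj e S x != 0 <->
  exists k : T -> nat, forall v, v \in S ->
    pair_Ev S x v = - (k v)%:R /\ coefpow ((valency adj S v)%:Z - 2) (k v) != 0.
Proof.
move=> nd sx; rewrite /zcoef; split => [nz|[k kP]].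
  case: (pickP (fun k : {ffun T -> 'I_(zbound adj e S x).+1} =>
     [&& [forall v, (v \notin S) ==> (val (k v) == 0%N)],
       \sum_(v in S) cscale (val (k v))%:R (dual S v) == x &
       \prod_(v in S) coefpow ((valency adj S v)%:Z - 2) (val (k v)) != 0]))
     => [k /and3P[_ /eqP kx /prodf_neq0 nzk]|none].
    exists (fun v => val (k v)) => v vS; split; last exact: nzk.
    by rewrite -(pair_comb S (fun w => (val (k w))%:R)) // kx.
  case/eqP: nz; apply: big1 => k /andP[k1 k2].
  by have := none k; rewrite k1 k2 /= => /negbT; rewrite negbK => /eqP.
have xE : x = \sum_(v in S) cscale (k v)%:R (dual S v).
  apply: (pair_inj S) => // [|v vS]; first exact: supp_comb.
  by rewrite pair_comb // (kP v vS).1.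
(* The dual cycles have nonnegative coordinates, so [k v * dual S v v <= x v]: the truncation at
   [zbound] loses no exponent. *)
have kb v : v \in S -> (k v < (zbound adj e S x).+1)%N.
  move=> vS; rewrite ltnS /zbound (bigD1 v) //= (leq_trans _ (leq_addr _ _)) //.
  suff : ((k v)%:Z <= Num.floor (x v / dual S v v)) by lia.
  rewrite floor_ge_int // ler_pdivlMr ?dual_gt0 // [in leRHS]xE sum_ffunE.
  rewrite (bigD1 v) //= -[leLHS]addr0 lerD //; first by rewrite [leRHS]ffunE.
  apply: sumr_ge0 => w /andP[wS _].
  by rewrite ffunE mulr_ge0 ?dual_ge0.
pose K : {ffun T -> 'I_(zbound adj e S x).+1} :=
  [ffun v => inord (if v \in S then k v else 0%N)].
have KE v : val (K v) = if v \in S then k v else 0%N.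
  rewrite ffunE /= inordK //; case: ifP => // /kb; exact.
have KP v : v \in S -> val (K v) = k v by move=> vS; rewrite KE vS.
rewrite (bigD1 K) /=; last first.
  apply/andP; split; first by apply/forallP=> v; apply/implyP=> /negbTE vS; rewrite KE vS.
  by apply/eqP; rewrite [RHS]xE; apply: eq_bigr => v vS; rewrite KP.
rewrite [X in _ + X]big1 => [|K' /andP[/andP[/forallP K'0 /eqP K'x] nK]].
  rewrite addr0; apply/prodf_neq0 => v vS; rewrite KP //; exact: (kP v vS).2.
(* Another contributing index represents the same [x], so pairing with [E_v] yields the same
   exponents. *)
case/eqP: nK; apply/ffunP => v; apply: val_inj; rewrite KE; case: ifP => vS; last first.
  by have /implyP := K'0 v; rewrite vS => /(_ isT)/eqP.
apply/eqP; rewrite -(eqr_nat rat); apply/eqP/oppr_inj.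
by rewrite -(kP v vS).1 -(pair_comb S (fun w => (val (K' w))%:R)) // K'x.
Qed.

Lemma pair_EG S v : v \in S -> pair_Ev S (EG S) v = (e v)%:~R + (valency adj S v)%:R.
Proof.
move=> vS; rewrite /pair_Ev (bigD1 v) //= ffunE vS mul1r {1}/Defs.Ient eqxx; congr (_ + _).
rewrite /valency -sum1_card natr_sum.
rewrite [RHS](eq_bigl (fun u => (u \in S) && adj v u)) => [|u]; last by rewrite inE.
rewrite [LHS]big_mkcondr [RHS]big_mkcondr /=.
by apply: eq_bigr => u uS; rewrite ffunE uS mul1r /Defs.Ient Hsym;
  case: eqP => [->|] //=; rewrite Hirr.
Qed.

(** A factor [n - j] with [0 <= j < k] can vanish only if [0 <= n < k]; for negative [n] no
    coefficient is zero. *)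
Lemma coefpow_neq0 (n : int) k : (n < 0) || (k%:Z <= n) -> coefpow n k != 0.
Proof.
move=> nk; rewrite /coefpow !mulf_neq0 ?invr_eq0 ?pnatr_eq0 ?signr_eq0 -?lt0n ?fact_gt0 //.
apply/prodf_neq0 => j _; rewrite pmulrn -rmorphB /= intr_eq0; have := ltn_ord j; lia.
Qed.

End Intersection.

(** * Remainders of an NN-elliptic sequence *)

Section NNsequence.
Variables (T : finType) (adj : rel T) (e : T -> int).
Hypothesis (Hsym : symmetric adj).
Variables (G : {set T}) (B : nat -> {set T}) (Z : nat -> cyc T) (m : nat).
Hypotheses (HG : elliptic adj e G) (HNN : NNseq adj e G B Z m).
Implicit Types (S : {set T}) (x y l : cyc T) (u v w : T).

Local Notation ZK := (Defs.ZK adj e).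
Local Notation "<< x , v >>" := (pair_Ev T adj e G x v).

Let X k : cyc T := ZK G - Cseq Z k.

Lemma NN_negdef : negdef adj e G. Proof. by case: HG. Qed.
Local Hint Resolve NN_negdef : core.

Lemma CseqS (W : nat -> cyc T) k : Cseq W k.+1 = Cseq W k + W k.+1.
Proof. by rewrite /Cseq big_ord_recr. Qed.

Lemma rem_rec k v : X k.+1 v = X k v - Z k.+1 v.
Proof. by rewrite /X CseqS opprD addrA cycBE. Qed.

Lemma rem_last : X m = 0.
Proof. by case: HNN => _ _ _ _ E; rewrite /X {1}E subrr. Qed.

Lemma NN_B_rem k : (k < m)%N -> B k.+1 = Defs.support (X k).
Proof. by case: HNN => _ _ _ H _ /H[]. Qed.

Lemma rem_neq0 k : (k < m)%N -> X k != 0.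
Proof. by case: HNN => _ _ _ H _ /H[]. Qed.

Lemma NN_Zmin k : (k < m)%N ->
  is_least (fun x => [/\ inL (B k.+1) x, x != 0 & inS' adj e (B k.+1) x]) (Z k.+1).
Proof. by case: HNN => _ _ H _ _ km; apply: H. Qed.

Lemma NN_Z0 :
  is_least (fun x => [/\ inL' adj e G x, inS' adj e G x & inL G (x - ZK G)]) (Z 0%N).
Proof. by case: HNN. Qed.

(** [Z k.+1] lives on [B k.+1], the support of [X k], so subtracting it creates no new support;
    integrality and nesting go through the same induction. *)
Lemma rem_inL k : (k <= m)%N -> inL G (X k) /\ ((k < m)%N -> B k.+1 \subset B k).
Proof.
elim: k => [|k IH] km.
  have [[_ _ [Zsupp Zint]] _] := NN_Z0.
  have X0L : inL G (X 0%N).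
    rewrite /X /Cseq big_ord1 -opprB; split=> [v /Zsupp E|v]; last by rewrite ffunE rpredN.
    by rewrite [LHS]ffunE E oppr0.
  split=> // m0; have [-> _ _ _ _] := HNN; rewrite NN_B_rem //.
  by apply/subsetP => v; rewrite inE; apply: contra_neqT; case: X0L => + _; apply.
have [[Xsupp Xint] _] := IH (ltnW km).
have [[[Zsupp Zint] _ _] _] := NN_Zmin _ km.
have out v : X k v = 0 -> X k.+1 v = 0.
  move=> Xv; rewrite rem_rec Zsupp ?subr0 //; last by rewrite NN_B_rem // inE Xv eqxx.
split; first split.
- by move=> v /Xsupp /out.
- by move=> v; rewrite rem_rec rpredB.
move=> km2; rewrite !NN_B_rem ?(ltnW km2) //; apply/subsetP => v; rewrite !inE.
by apply: contra_neq; apply: out.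
Qed.

Lemma NN_B_anti j k : (j <= k <= m)%N -> B k \subset B j.
Proof.
elim: k => [|k IH] /andP[jk km]; first by move: jk; rewrite leqn0 => /eqP ->.
case: (ltngtP j k.+1) jk => // [jk _|-> _]; last exact: subxx.
have [_ /(_ km) sub] := rem_inL _ (ltnW km).
by apply: subset_trans sub (IH _); rewrite -ltnS jk ltnW.
Qed.

Lemma NN_B_subG k : (k <= m)%N -> B k \subset G.
Proof. by case: HNN => <- _ _ _ _ km; apply: NN_B_anti. Qed.

Lemma NN_Z_antinef k v : (k <= m)%N -> v \in B k -> <<Z k, v>> <= 0.
Proof.
case: k => [|k] km vB.
  have [[_ ZS _] _] := NN_Z0.
  have vG : v \in G by case: HNN vB => ->.
  by rewrite -form_Ev // ZS.
have [[[Zsupp _] _ ZS] _] := NN_Zmin _ km.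
rewrite (pair_Ev_sub T adj e v (NN_B_subG _ km) Zsupp).
by have := ZS v vB; rewrite form_Ev.
Qed.

Lemma NN_Z_ge0 k v : (k < m)%N -> 0 <= Z k.+1 v.
Proof.
move=> km; have [[[Zsupp _] _ ZS] _] := NN_Zmin _ km.
case: (boolP (v \in B k.+1)) => [vB|/Zsupp -> //].
apply: (antinef_ge0 T adj e (B k.+1)) => //.
  exact: negdefS (NN_B_subG _ km) NN_negdef.
by move=> w wB; have := ZS w wB; rewrite form_Ev.
Qed.

(** Downward induction from [X m = 0], each step adding back a nonnegative [Z]. *)
Lemma rem_ge0 k v : (k <= m)%N -> 0 <= X k v.
Proof.
move=> km; rewrite -(subKn km); elim: (m - k)%N => [|d IH]; first by rewrite subn0 rem_last ffunE.
(* Once [d >= m], truncated subtraction gives 0 on both sides and nothing changes. *)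
case: (ltnP d m) => dm; last by have -> : (m - d.+1 = m - d)%N by lia.
have E : (m - d = (m - d.+1).+1)%N by lia.
have := IH; rewrite E rem_rec.
have : 0 <= Z (m - d.+1).+1 v by apply: NN_Z_ge0; lia.
lra.
Qed.

Lemma rem_mono j k v : (j <= k <= m)%N -> X k v <= X j v.
Proof.
elim: k => [|k IH] /andP[jk km]; first by move: jk; rewrite leqn0 => /eqP ->.
case: (ltngtP j k.+1) jk => // [jk _|-> _]; last exact: lexx.
apply: le_trans (IH _); last by rewrite -ltnS jk ltnW.
by rewrite rem_rec gerBl NN_Z_ge0.
Qed.

Lemma pair_rem k v : v \in G -> <<X k, v>> = (e v)%:~R + 2 - <<Cseq Z k, v>>.
Proof. by move=> vG; rewrite pair_EvB pair_ZK. Qed.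

(** Each [Z j] with [j <= k] is anti-nef on [B j], which contains [B k]. *)
Lemma Cseq_antinef k v : (k <= m)%N -> v \in B k -> <<Cseq Z k, v>> <= 0.
Proof.
move=> km vB; rewrite pair_Ev_sum; apply: sumr_le0 => j _.
have jk : (j <= k)%N by rewrite -ltnS.
rewrite NN_Z_antinef ?(leq_trans jk) //.
by apply: (subsetP (NN_B_anti j k _)) vB; rewrite jk.
Qed.

(* chi (X k) = (C_k, X k) / 2 is nonnegative by ellipticity, while C_k is
   anti-nef on the support B k.+1 of X k: all terms of (C_k, X k) vanish. *)
Lemma Cseq_orth k v : (k < m)%N -> v \in B k.+1 -> <<Cseq Z k, v>> = 0.
Proof.
move=> km vB.
have anti w : w \in B k.+1 -> <<Cseq Z k, w>> <= 0.
  move=> wB; apply: Cseq_antinef; first exact: ltnW.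
  by apply: (subsetP (NN_B_anti k k.+1 _)) wB; rewrite leqnSn.
have XB w : w \notin B k.+1 -> X k w = 0 by rewrite NN_B_rem // inE negbK => /eqP.
have [XL _] := rem_inL _ (ltnW km).
have chi_ge0 : 0 <= chi adj e G (X k).
  case: HG => _ _ _ H _; apply: H => //; split; last exact: rem_neq0.
  by move=> w; rewrite ffunE rem_ge0 // ltnW.
have form_ge0 : 0 <= \sum_(w in G) X k w * <<Cseq Z k, w>>.
  suff E : chi adj e G (X k) = (\sum_(w in G) X k w * <<Cseq Z k, w>>) / 2 by lra.
  have C_rem : X k - ZK G = - Cseq Z k by rewrite /X addrAC subrr add0r.
  rewrite /chi C_rem (formC T adj e Hsym) formE -sumrN; congr (_ / _); apply: eq_bigr => w _.
  by rewrite pair_EvN mulrN opprK.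
have vG : v \in G by apply: (subsetP (NN_B_subG _ km)).
apply/eqP; rewrite eq_le anti //=; rewrite leNgt; apply/negP => lt0.
have X_gt0 : 0 < X k v.
  by rewrite lt0r rem_ge0 ?(ltnW km) // andbT; move: vB; rewrite NN_B_rem // inE.
move: form_ge0; rewrite (bigD1 v) //= leNgt => /negP[].
rewrite -[ltRHS]addr0 ltr_leD ?pmulr_rlt0 //; apply: sumr_le0 => w /andP[wG _].
case: (boolP (w \in B k.+1)) => [wB|/XB ->]; last by rewrite mul0r.
by rewrite mulr_ge0_le0 ?rem_ge0 ?anti // ltnW.
Qed.

(** * Comparison of the sequences of [G] and [G'] *)

Section Extension.
Variables (G' : {set T}) (B' : nat -> {set T}) (Z' : nat -> cyc T) (m' i : nat).
Hypotheses (nd' : negdef adj e G') (HNN' : NNseq adj e G' B' Z' m').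
Hypotheses (Hi : (i < m)%N) (HiB1 : B i.+1 \subset G') (HiB2 : G' \proper B i).

Lemma ext_subG : G' \subset G.
Proof. exact: subset_trans (proper_sub HiB2) (NN_B_subG _ (ltnW Hi)). Qed.

(** [X i] is supported on [B i.+1], hence on [G'], and later remainders lie between 0 and [X i]. *)
Lemma rem_supp_ext k : (i <= k <= m)%N -> supp_on G' (X k).
Proof.
move=> /andP[ik km] v vG'.
have : X i v = 0.
  apply/eqP; apply: contraNT vG' => Xv; apply: (subsetP HiB1).
  by rewrite NN_B_rem // inE.
by have := rem_ge0 k v km; have := rem_mono i k v; rewrite ik km => /(_ isT); lra.
Qed.

(* ZK G - l is again anti-nef on G, so it dominates Z 0; subtracting the C_j
   one at a time, which is harmless on B j.+1 by orthogonality, gives l <= X j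
   for every j <= i, since G' is strictly smaller than B j.+1 for j < i. *)
Lemma antinef_class_le l : inL G' l -> cle 0 l ->
  (forall v, v \in G' -> pair_Ev T adj e G' (ZK G' - l) v <= 0) -> cle l (X i).
Proof.
move=> [lsupp lint] l0 lS.
have lv0 v : 0 <= l v by have := l0 v; rewrite ffunE.
have lsuppG : supp_on G l := supp_onS _ ext_subG lsupp.
(* On [G'] both canonical cycles pair to [e v + 2], so the assumption on [G'] applies. Outside [G'],
   [e v + 2 <= 0] while the effective cycle [l] pairs nonnegatively. *)
have pair_le0 v : v \in G -> <<ZK G - l, v>> <= 0.
  move=> vG; rewrite pair_EvB pair_ZK //; case: (boolP (v \in G')) => vG'.
    by have := lS v vG'; rewrite pair_EvB pair_ZK // -(pair_Ev_sub T adj e v ext_subG lsupp).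
  have := pair_Ev_ge0_out T adj e G' l v lv0 vG'.
  rewrite -(pair_Ev_sub T adj e v ext_subG lsupp).
  have : (e v)%:~R <= (-2)%:~R :> rat by case: HG => _ _ He _ _; rewrite ler_int He.
  lra.
suff step j : (j <= i)%N -> cle l (X j) by apply: step.
elim: j => [_|j IH ji].
  have Zle : cle (Z 0%N) (ZK G - l).
    have [_ least] := NN_Z0; apply: least; split.
    - split=> v vG; first by rewrite (cycBE T) lsuppG ?supp_ZK ?subr0.
      rewrite form_Ev // pair_EvB pair_ZK // rpredB ?pair_Ev_int //.
      by rewrite rpredD ?rpred_int // rpred_nat.
    - by move=> v vG; rewrite form_Ev // pair_le0.
    - rewrite addrAC subrr add0r; split=> v; last by rewrite ffunE rpredN.
      by move=> vG; rewrite [LHS]ffunE lsuppG ?oppr0.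
  move=> v; have := Zle v; rewrite /X /Cseq big_ord1 !(cycBE T); lra.
have jm : (j < m)%N := leq_trans ji (ltnW Hi).
have Xl v : (X j - l) v = X j v - l v by exact: cycBE.
have G'sub : G' \proper B j.+1.
  by apply: proper_sub_trans HiB2 (NN_B_anti _ _ _); rewrite ji ltnW.
have [[Xsupp Xint] _] := rem_inL j (ltnW jm).
have [_ least] := NN_Zmin j jm.
suff Zle : cle (Z j.+1) (X j - l).
  by move=> v; rewrite rem_rec; have := Zle v; rewrite Xl; lra.
have Xlsupp : supp_on (B j.+1) (X j - l).
  move=> v vB; rewrite Xl (supp_onS _ (proper_sub G'sub) lsupp) // subr0.
  by apply/eqP; apply: contraNT vB => Xv; rewrite NN_B_rem // inE.
apply: least; split.
- by split=> // v; rewrite Xl rpredB.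
(* At a vertex of [B j.+1] outside [G'], [l] vanishes but [X j] does not. *)
- have [_ [v vB vG']] := properP G'sub.
  apply: contraTneq vB => /ffunP/(_ v); rewrite Xl [RHS]ffunE lsupp // subr0 => Xv.
  by rewrite NN_B_rem // inE Xv eqxx.
move=> v vB; rewrite form_Ev //.
have vG : v \in G by apply: (subsetP (NN_B_subG _ jm)).
rewrite -(pair_Ev_sub T adj e v (NN_B_subG _ jm) Xlsupp) pair_EvB pair_rem //.
rewrite Cseq_orth // subr0.
by have := pair_le0 v vG; rewrite pair_EvB pair_ZK.
Qed.

(** On [G'], [ZK G' - X i] pairs like [Cseq Z i], which is anti-nef on [B i]; hence it dominates the
    least element [Z' 0]. So [ZK G' - Z' 0] is at least [X i], in particular effective, and
    [antinef_class_le] gives the reverse inequality. *)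
Lemma ext_Z0 : ZK G' - Cseq Z' 0 = X i.
Proof.
have [_ [[[sZ _] Zanti [_ Zint]] least] _ _ _] := HNN'.
have im : (i <= i <= m)%N by rewrite leqnn ltnW.
have [[_ Xint] _] := rem_inL i (ltnW Hi).
have Xsupp := rem_supp_ext i im.
rewrite /Cseq big_ord1.
have Z0le : cle (Z' 0%N) (ZK G' - X i).
  have pairX v : v \in G' -> pair_Ev T adj e G' (ZK G' - X i) v = <<Cseq Z i, v>>.
    move=> vG'; rewrite pair_EvB pair_ZK // -(pair_Ev_sub T adj e v ext_subG Xsupp).
    by rewrite pair_rem ?(subsetP ext_subG) //; lra.
  apply: least; split.
  - split=> v vG'; first by rewrite (cycBE T (ZK G')) Xsupp ?supp_ZK ?subr0.
    rewrite form_Ev // pair_EvB pair_ZK // rpredB ?pair_Ev_int //.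
    by rewrite rpredD ?rpred_int // rpred_nat.
  - move=> v vG'; rewrite form_Ev // pairX //; apply: Cseq_antinef; first exact: ltnW.
    exact: (subsetP (proper_sub HiB2)).
  - rewrite addrAC subrr add0r; split=> v; last by rewrite ffunE rpredN.
    by move=> vG; rewrite [LHS]ffunE Xsupp ?oppr0.
have lE v : (ZK G' - Z' 0%N) v = ZK G' v - Z' 0%N v by exact: cycBE.
have Xle v : X i v <= ZK G' v - Z' 0%N v.
  by have := Z0le v; rewrite (cycBE T (ZK G')); lra.
have lelX : cle (ZK G' - Z' 0%N) (X i).
  apply: antinef_class_le.
  - split=> v; first by move=> vG'; rewrite lE sZ ?supp_ZK ?subr0.
    by rewrite lE -opprB rpredN -(cycBE T).
  - by move=> v; rewrite lE [leLHS]ffunE (le_trans (rem_ge0 i v (ltnW Hi))).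
  - by move=> v vG'; rewrite opprB addrC subrK -form_Ev // Zanti.
apply/ffunP => v; apply/eqP; rewrite eq_le lelX /=; by rewrite lE Xle.
Qed.

(** Equal remainders have equal supports, hence equal minimal cycles, hence equal next
    remainders. *)
Lemma rem_ext d : (i + d <= m)%N ->
  (d <= m')%N /\ ZK G' - Cseq Z' d = X (i + d).
Proof.
elim: d => [|d IH] dm; first by rewrite addn0 ext_Z0.
have {}dm : (i + d < m)%N by rewrite -addnS.
have [dm' E] := IH (ltnW dm).
have [_ _ Zmin' step last'] := HNN'.
have {}dm' : (d < m')%N.
  (* The sequence of [G'] cannot stop here: at [d = m'] its remainder would be 0, but [X (i + d)] is
     not. *)
  rewrite ltn_neqAle dm' andbT; apply: contraTneq isT => dm'E.
  by have := rem_neq0 _ dm; rewrite -E dm'E {1}last' subrr eqxx.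
split=> //.
have BE : B' d.+1 = B (i + d).+1 by have [_ ->] := step d dm'; rewrite E NN_B_rem.
have [Zin Zle] := NN_Zmin _ dm.
have [Zin' Zle'] := Zmin' d.+1 dm'; rewrite BE in Zin' Zle'.
have ZE : Z' d.+1 = Z (i + d).+1.
  by apply/ffunP => v; apply/eqP; rewrite eq_le Zle // Zle'.
by rewrite addnS CseqS opprD addrA E ZE /X CseqS opprD addrA.
Qed.

End Extension.

End NNsequence.

(* The exponent of E_v^* in Z_K - E - x is minus this number. *)
Lemma pair_ZK_EG T adj e (Hsym : symmetric adj) (Hirr : irreflexive adj)
    (S : {set T}) (x : cyc T) v : negdef adj e S -> v \in S ->
  pair_Ev T adj e S (ZK adj e S - EG S - x) v =
  2 - (valency adj S v)%:R - pair_Ev T adj e S x v.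
Proof. by move=> nd vS; rewrite !pair_EvB pair_ZK // pair_EG //; lra. Qed.

(** * Valencies and pairings under restriction to a subgraph *)

Lemma valency_split (T : finType) (adj : rel T) (G G' : {set T}) v : G' \subset G ->
  valency adj G v = (valency adj G' v + #|[set w in G :\: G' | adj v w]|)%N.
Proof.
move=> sub; rewrite /valency -(cardsID G').
by congr addn; apply: eq_card => w; rewrite !inE;
  case: (boolP (w \in G')) => [/(subsetP sub) ->|]; rewrite ?andbT ?andbF.
Qed.

Lemma pair_split T adj e (G G' : {set T}) (x : cyc T) v : G' \subset G -> v \in G' ->
  pair_Ev T adj e G x v = pair_Ev T adj e G' x v +
    \sum_(w in [set w in G :\: G' | adj w v]) x w.
Proof.
move=> sub vG'; rewrite /pair_Ev (bigID (mem G')) /=; congr (_ + _).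
  by apply: eq_bigl => u; rewrite andb_idl //; apply: (subsetP sub).
rewrite [LHS](eq_bigl (mem (G :\: G'))) => [|u]; last by rewrite !inE andbC.
rewrite [RHS](eq_bigl (fun w => (w \in G :\: G') && adj w v)) => [|u]; last by rewrite inE.
rewrite [RHS]big_mkcondr /=; apply: eq_bigr => u; rewrite inE => /andP[uG' _].
have /negbTE uv : u != v by apply: contraNneq uG' => ->.
by rewrite /Ient uv; case: ifP => _; rewrite ?mulr1 ?mulr0.
Qed.

(** * Restriction of the support *)

Theorem mainTheorem5 (T : finType) (adj : rel T) (e : T -> int)
  (Hsym : symmetric adj) (Hirr : irreflexive adj)
  (G G' : {set T})
  (HG : elliptic adj e G) (HG' : elliptic adj e G')
  (Hproper : G' \proper G) (Hconn : connectedS adj G')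
  (B : nat -> {set T}) (Z : nat -> cyc T) (m : nat)
  (HNN : NNseq adj e G B Z m)
  (B' : nat -> {set T}) (Z' : nat -> cyc T) (m' : nat)
  (HNN' : NNseq adj e G' B' Z' m')
  (i : nat) (Hi : (i < m)%N)
  (HiB1 : B i.+1 \subset G') (HiB2 : G' \proper B i)
  (Hend : forall v, v \in boundary adj G G' -> valency adj G' v = 1%N) :
  forall k, (i <= k <= m)%N ->
  forall l : cyc T, SuppJ adj e G (Cseq Z k) l ->
    SuppJ adj e G' (Cseq Z' (k - i)) (restrict G' l).
Proof.
move=> k /andP[ik km] l [[[lsupp lint] lneg wl] [[mu lE] _ CE]].
have nd : negdef adj e G by case: HG.
have nd' : negdef adj e G' by case: HG'.
have sub : G' \subset G := proper_sub Hproper.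
have [X XE] : exists X : cyc T, X = ZK adj e G - Cseq Z k by eexists.
have [_ remE] : (k - i <= m')%N /\ ZK adj e G' - Cseq Z' (k - i) = X.
  have := rem_ext T adj e Hsym G B Z m HG HNN G' B' Z' m' i nd' HNN' Hi HiB1 HiB2 (k - i).
  by rewrite subnKC // XE; apply.
have Xsupp : supp_on G' X.
  by rewrite XE; apply: (rem_supp_ext T adj e G B Z m HG HNN G' i) => //; rewrite ik km.
have X_ge0 v : 0 <= X v by rewrite XE; apply: (rem_ge0 T adj e G B Z m).
have lv v : v \in G -> l v = X v - 1 - (if l v < 0 then (mu v)%:R else 0).
  move=> vG; rewrite [LHS](congr1 (fun f : cyc T => f v) lE).
  have -> : ZK adj e G - EG G - Cseq Z k = X - EG G by rewrite XE addrAC.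
  rewrite !(cycBE T) [EG G v]ffunE vG sum_ffunE; congr (_ - _ - _).
  rewrite big_mkcondr /= (bigD1 v) //= big1 => [|w /andP[_ wv]].
    by rewrite addr0; case: ifP => // _; rewrite !ffunE eqxx mulr1.
  by case: ifP => // _; rewrite !ffunE eq_sym (negbTE wv) mulr0.
(* Off [G'] the remainder vanishes, so [l w >= 0] would give [l w = -1]; thus [l w] is negative and
   [mu w] is present. *)
have lout w : w \in G :\: G' -> l w = - 1 - (mu w)%:R.
  rewrite inE => /andP[wG' wG]; have := lv w wG; rewrite Xsupp //.
  by case: ltP => ? ?; lra.
have rE v : v \in G' -> restrict G' l v = l v by move=> vG'; rewrite ffunE vG'.
have rsupp : supp_on G' (restrict G' l) by move=> v /negbTE vG'; rewrite ffunE vG'.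
split; first split.
- split=> // v; rewrite ffunE; case: ifP => // _; exact: rpred0.
(* Since [l] is negative off [G'], a restriction negative on all of [G'] would make [l] negative on
   all of [G]. *)
- move=> neg; apply: lneg => v vG; case: (boolP (v \in G')) => vG'.
    by rewrite -rE // neg.
  rewrite lout ?inE ?vG' //; have : 0 <= (mu v)%:R :> rat by exact: ler0n.
  lra.
- have wsupp (S : {set T}) (x : cyc T) : supp_on S x -> supp_on S (ZK adj e S - EG S - x).
    move=> sx v vS; rewrite !(cycBE T) sx // supp_ZK // [EG S v]ffunE (negbTE vS).
    by rewrite !subr0.
  have [+ _] := zcoef_neq0P T adj e G _ nd (wsupp _ _ lsupp).
  move=> /(_ wl) [n nP].
  apply/(zcoef_neq0P T adj e G' _ nd' (wsupp _ _ rsupp)).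
  pose N v : {set T} := [set w in G :\: G' | adj v w].
  (* On G :\: G' one has l w = -1 - mu w, so cutting off the neighbours of v
     there changes 2 - valency - (l, E_v) by the sum of the mu w. *)
  exists (fun v => (n v + \sum_(w in N v) mu w)%N) => v vG'.
  have vG := subsetP sub _ vG'.
  have [nv cv] := nP v vG; split.
    rewrite pair_ZK_EG // in nv; rewrite pair_ZK_EG //.
    have := valency_split T adj G G' v sub; rewrite -/(N v) => vs.
    have ps := pair_split T adj e G G' l v sub vG'.
    have -> : pair_Ev T adj e G' (restrict G' l) v = pair_Ev T adj e G' l v.
      by apply: eq_bigr => u uG'; rewrite rE.
    have sE : \sum_(w in [set w in G :\: G' | adj w v]) l w =
              - #|N v|%:R - (\sum_(w in N v) mu w)%:R.
      rewrite natr_sum -sum1_card natr_sum -!sumrN -big_split /=.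
      apply: eq_big => [w|w]; first by rewrite !inE Hsym.
      by rewrite inE => /andP[wG _]; rewrite lout.
    rewrite sE in ps; rewrite vs natrD in nv; rewrite natrD.
    lra.
  (* On the boundary the power is [1 - 2 = -1], whose expansion has no zero coefficient, so the
     enlarged exponent is harmless. *)
  case: (boolP (v \in boundary adj G G')) => [vb|vb].
    by apply: coefpow_neq0; rewrite Hend.
  (* Away from the boundary no neighbour is cut off: valency and exponent stay the same. *)
  have N0 : N v = set0.
    apply/setP => w; rewrite [RHS]inE; apply/negbTE; apply: contra vb.
    by rewrite !inE vG' /= => wN; apply/existsP; exists w; rewrite inE.
  by move: cv; rewrite (valency_split T adj G G' v sub) -/(N v) N0 cards0 big_set0 !addn0.
split.
(* The same multiplicities work, because [X] is the remainder in both graphs. *)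
- exists mu.
  have -> : ZK adj e G' - EG G' - Cseq Z' (k - i) = X - EG G' by rewrite addrAC remE.
  apply/ffunP => v; rewrite !(cycBE T) sum_ffunE [EG G' v]ffunE.
  case: (boolP (v \in G')) => vG'; last first.
    rewrite rsupp // Xsupp // big1 ?subr0 // => w /andP[wG' _].
    by rewrite !ffunE; case: eqP => [vw|_]; rewrite ?mulr0 //; rewrite vw wG' in vG'.
  rewrite rE // [LHS]lv ?(subsetP sub) //; congr (_ - _ - _).
  rewrite big_mkcondr /= (bigD1 v) //= big1 => [|w /andP[_ wv]].
    by rewrite addr0 rE //; case: ifP => // _; rewrite !ffunE eqxx mulr1.
  by case: ifP => // _; rewrite !ffunE eq_sym (negbTE wv) mulr0.
- by move=> v; rewrite -subr_ge0 -(cycBE T) remE.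
(* By [CE], [X] vanishes wherever [l] is negative, and [X] is also the remainder for [G']. *)
- move=> v vG'; rewrite rE // => lneg0; apply/eqP; rewrite eq_sym -subr_eq0 -(cycBE T) remE.
  by rewrite XE (cycBE T) CE ?subrr // (subsetP sub).
Qed.
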